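(* If $F$ is a 2-balanced graph with $e(F)\ge 2$, then for every integer $2\le r< v(F)$, the maximum number of copies of $K_r$ in an $n$-vertex $F$-free graph is $\Omega\left(n^{2-\frac{v(F)-2}{e(F)-1}}\right)$ (as $n\to\infty$, with the implicit constant depending on $F$ and $r$).
   Context: A graph $F$ is 2-balanced if for every subgraph $F'\subseteq F$ with $v(F')\ge 3$ we have $\frac{e(F')-1}{v(F')-2}\le \frac{e(F)-1}{v(F)-2}$, where $v(\cdot),e(\cdot)$ denote numbers of vertices and edges. A graph is $F$-free if it contains no subgraph isomorphic to $F$. *)

(* Defs.v *)
From HB Require Import structures.
From mathcomp Require Import all_boot all_order all_algebra.

Set Implicit Arguments.
Unset Strict Implicit.
Unset Printing Implicit Defensive.

Import Order.TTheory GRing.Theory Num.Theory.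

Record sgraph (T : finType) := SGraph {
  edges : {set {set T}};
  edgesP : [forall e in edges, #|e| == 2]
}.

HB.instance Definition _ (T : finType) := [isSub for @edges T].
HB.instance Definition _ (T : finType) := [Countable of sgraph T by <:].
HB.instance Definition _ (T : finType) := [Finite of sgraph T by <:].

(* A pair S = (W, D) encodes the graph with vertex set W and edge set D;
   subgraphs need be neither induced nor spanning. *)
Definition subgraph (T : finType) (G : sgraph T)
    (S : {set T} * {set {set T}}) : bool :=
  (S.2 \subset edges G) && (S.2 \subset powerset S.1).

Definition isomorphic_to (T U : finType) (F : sgraph T)
    (S : {set U} * {set {set U}}) : bool :=
  [exists f : {ffun T -> U},
    [&& injectiveb f, f @: [set: T] == S.1
      & [set f @: (e : {set T}) | e in edges F] == S.2]].

Definition copies (T U : finType) (F : sgraph T) (G : sgraph U) :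
    {set {set U} * {set {set U}}} :=
  [set S | subgraph G S && isomorphic_to F S].

Definition is_free (T U : finType) (F : sgraph T) (G : sgraph U) : bool :=
  copies F G == set0.

(* The division is in rat, so that the numerator is -1 for an edgeless
   subgraph. *)
Definition two_balanced (T : finType) (F : sgraph T) : Prop :=
  forall S : {set T} * {set {set T}}, subgraph F S -> 3 <= #|S.1| ->
    ((#|S.2|%:R - 1) / (#|S.1|%:R - 2) <=
     (#|edges F|%:R - 1) / (#|T|%:R - 2) :> rat)%R.

Lemma complete_edgesP (r : nat) :
  [forall e in [set e : {set 'I_r} | #|e| == 2], #|e| == 2].
Proof. by apply/forall_inP => e; rewrite inE. Qed.

Definition complete_graph (r : nat) : sgraph 'I_r :=
  SGraph (complete_edgesP r).

(* The generalized Turan number ex(n, H, F): the maximum number of copies of H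
   in an F-free graph on n vertices. *)
Definition ex_copies (T U : finType) (n : nat) (H : sgraph U) (F : sgraph T) :
    nat :=
  \max_(G : sgraph 'I_n | is_free F G) #|copies H G|.

(* Main.v *)
(** Deletion method on random cliques.  Put v = v(F), m = e(F) and
    x = (v - 2) / (m - 1), and choose every r-subset of [n] independently with
    probability p = c n^(2 - r - x); the expected number of chosen sets is of
    order c n^(2 - x).  Let G be the union of the cliques on the chosen sets.
    A copy of F in G determines a partition of the edges of F, according to the
    chosen set that covers them, and it has at least two blocks because r < v
    and F has no isolated vertex.  For a block V spanning s vertices, there are
    at most n^(r - s) sets covering it and p n^(r - s) = c n^(2 - x - s)
    <= c n^(- x |V|) by 2-balancedness.  Hence the expected number of bad
    configurations is O(c^2 n^(v - x m)) = O(c^2 n^(2 - x)), and for small c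
    deleting one set from each of them keeps a positive proportion. *)

Require Import Defs.
From mathcomp Require Import all_boot all_order all_algebra.
From mathcomp Require Import reals exp ring lra zify.
Set Implicit Arguments.
Unset Strict Implicit.
Unset Printing Implicit Defensive.
Import Order.TTheory GRing.Theory Num.Theory.
Local Open Scope ring_scope.

(** * Random subsets and the deletion method *)

(** This is the probability that a [p]-random subset contains [B]. Expand the product over [x] of
    [p + 0] on [B] and [p + (1 - p)] off [B]. *)
Lemma sum_weight_supersets (R : comPzRingType) (X : finType) (p : R)
    (B : {set X}) :
  \sum_(S : {set X} | B \subset S) \prod_x (if x \in S then p else 1 - p) =
  p ^+ #|B|.
Proof.
have -> : p ^+ #|B| = \prod_x (p + if x \in B then 0 else 1 - p).
  rewrite -prodr_const [LHS]big_mkcond /=; apply: eq_bigr => x _.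
  by case: ifP => _; rewrite ?addr0 ?subrKC.
rewrite bigA_distr big_mkcond /=; apply: eq_bigr => S _.
case: ifPn => [/subsetP sBS | /subsetPn[x Bx S'x]].
  apply: eq_bigr => x _; case: ifPn => // S'x.
  by case: ifPn => // /sBS; rewrite (negPf S'x).
by rewrite (bigD1 x) //= (negPf S'x) Bx mul0r.
Qed.

(** Some [S] does at least as well as the mean of its number of points in [D] minus its number of
    contained [B j]; removing one point of each contained [B j] leaves [A]. *)
Lemma deletion_method (R : realFieldType) (X J : finType) (p : R)
    (D : {set X}) (Q : pred J) (B : J -> {set X}) :
  0 <= p <= 1 -> (forall j, Q j -> B j != set0) ->
  exists A : {set X},
    [/\ A \subset D, forall j, Q j -> ~~ (B j \subset A)
      & p * #|D|%:R - \sum_(j | Q j) p ^+ #|B j| <= #|A|%:R].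
Proof.
move=> /andP[p_ge0 p_le1] B_n0.
pose w (S : {set X}) := \prod_x (if x \in S then p else 1 - p).
have w_ge0 S : 0 <= w S.
  by apply: prodr_ge0 => x _; case: ifP; rewrite ?subr_ge0.
have sum_w (C : {set X}) : \sum_S w S * (C \subset S)%:R = p ^+ #|C|.
  rewrite -sum_weight_supersets big_mkcond [RHS]big_mkcond /=.
  by apply: eq_bigr => S _; case: ifP; rewrite ?mulr1 ?mulr0.
pose bad (S : {set X}) := [set j | Q j & B j \subset S].
pose val (S : {set X}) : R := #|S :&: D|%:R - #|bad S|%:R.
have card_sum (I : finType) (P P' : pred I) :
    #|[set i | P i & P' i]|%:R = \sum_(i | P i) (P' i)%:R :> R.
  rewrite -sum1_card natr_sum big_mkcond [RHS]big_mkcond /=.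
  by apply: eq_bigr => i _; rewrite inE; case: (P i); case: (P' i).
(* The mean of [val] over random [S], each point being kept with probability
   [p]. *)
have mean : \sum_S w S * val S = p * #|D|%:R - \sum_(j | Q j) p ^+ #|B j|.
  rewrite (eq_bigr (fun S => \sum_(x in D) w S * ([set x] \subset S)%:R
    - \sum_(j | Q j) w S * (B j \subset S)%:R)) => [|S _]; last first.
    rewrite mulrBr -!mulr_sumr -!card_sum.
    by congr (_ * _%:R - _); apply: eq_card => x; rewrite !inE sub1set andbC.
  rewrite big_split /= sumrN [X in X - _]exchange_big [X in _ - X]exchange_big.
  congr (_ - _); last by apply: eq_bigr.
  rewrite (eq_bigr (fun=> p)) => [|x _]; last by rewrite sum_w cards1.
  by rewrite sumr_const mulr_natr.
have [S _ S_max] := @arg_maxP _ _ _ set0 predT val isT.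
have S_val : p * #|D|%:R - \sum_(j | Q j) p ^+ #|B j| <= val S.
  (* The weights have total mass 1, by [sum_w] at the empty set. *)
  rewrite -mean -[leRHS]mul1r -(expr0 p) -(cards0 X) -sum_w mulr_suml.
  by apply: ler_sum => S' _; rewrite sub0set mulr1 ler_wpM2l //; apply: S_max.
(* The point to delete from [B j]; the value [None] is excluded by [B_n0]. *)
pose pt j := [pick x in B j].
pose del := [set x | Some x \in [set pt j | j in bad S]].
have del_le : (#|del| <= #|bad S|)%N.
  rewrite -(card_imset del Some_inj).
  apply: leq_trans (leq_imset_card pt _); apply: subset_leq_card.
  by apply/subsetP=> _ /imsetP[x + ->]; rewrite inE.
exists ((S :&: D) :\: del); split.
- by rewrite (subset_trans (subsetDl _ _)) ?subsetIr.
- move=> j Qj; apply/negP => /subsetP sBA.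
  have : B j \subset S.
    by apply/subsetP => x /sBA; rewrite !inE => /and3P[].
  case def_x: (pt j) => [x|]; last first.
    move: def_x (B_n0 j Qj); rewrite /pt; case: pickP => // B0 _.
    by case/set0Pn=> x; rewrite [_ \in _]B0.
  have Bx : x \in B j by move: def_x; rewrite /pt; case: pickP => // y ? [<-].
  move=> sBS; move: (sBA x Bx); rewrite !inE => /andP[/negP[]].
  by rewrite -def_x imset_f // inE Qj.
- apply: le_trans S_val _; rewrite lerBlDr -natrD ler_nat.
  rewrite -(cardsID del (S :&: D)) addnC leq_add2l.
  exact: leq_trans (subset_leq_card (subsetIr _ _)) del_le.
Qed.

(** * Binomial estimates *)

Lemma leq_bin_expn n k : ('C(n, k) <= n ^ k)%N.
Proof.
apply: (@leq_trans (n ^_ k)); first by rewrite -bin_ffact leq_pmulr ?fact_gt0.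
elim: k => // k IHk; rewrite ffactnSr expnSr.
by rewrite leq_mul // leq_subr.
Qed.

(** Each factor [n - k] of the falling factorial, with [k < r <= n], is at least [n / r]. *)
Lemma leq_expn_bin n r :
  (0 < r <= n)%N -> (n ^ r <= 'C(n, r) * (r`! * r ^ r))%N.
Proof.
case/andP=> r_gt0 le_rn; rewrite mulnA bin_ffact.
suff IHr k : (k <= r -> n ^ k <= n ^_ k * r ^ k)%N by apply: IHr.
elim: k => // k IHk lt_kr.
rewrite expnSr ffactnSr expnSr mulnACA leq_mul ?IHk ?(ltnW lt_kr) //.
have [d def_n] : exists d, (n = k + d.+1)%N.
  by exists (n - k.+1)%N; rewrite addnS -addSn subnKC // (leq_trans lt_kr).
rewrite def_n addKn; nia.
Qed.

(** The map from [K] to [K :\: S] is injective into the sets of size [r - #|S|]. The product form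
    also covers [#|S| > r], where no such [K] exists. *)
Lemma card_supersets (U : finType) r (S : {set U}) :
  (#|[set K : {set U} | (#|K| == r) && (S \subset K)]| * #|U| ^ #|S| <=
   #|U| ^ r)%N.
Proof.
have [lt_rS | le_Sr] := ltnP r #|S|.
  rewrite eq_card0 // => K; rewrite !inE; apply/negP => /andP[/eqP cardK].
  by move/subset_leq_card; rewrite cardK leqNgt lt_rS.
rewrite -[in leqRHS](subnK le_Sr) expnD leq_mul //.
rewrite (leq_trans _ (leq_bin_expn _ _)) //.
have inj : {in [set K : {set U} | (#|K| == r) && (S \subset K)] &,
    injective (fun K => K :\: S)}.
  move=> K L; rewrite !inE => /andP[_ SK] /andP[_ SL] eqKL.
  by rewrite -(setID K S) -(setID L S) eqKL !(setIidPr _).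
rewrite -card_draws -(card_in_imset inj); apply: subset_leq_card.
apply/subsetP=> _ /imsetP[K + ->]; rewrite !inE => /andP[/eqP <- SK].
by rewrite cardsD (setIidPr SK).
Qed.

(** * Consequences of 2-balancedness *)

Lemma card_edge (T : finType) (F : sgraph T) e : e \in edges F -> #|e| = 2.
Proof. by move=> Fe; apply/eqP; move/forall_inP: (edgesP F); apply. Qed.

Lemma card_cover_edges (T : finType) (F : sgraph T) (V : {set {set T}}) :
  V \subset edges F -> (1 < #|V|)%N -> (2 < #|cover V|)%N.
Proof.
move=> /subsetP sVF /card_gt1P[e1 [e2 [Ve1 Ve2 ne12]]].
have sub e : e \in V -> e \subset cover V by move=> Ve; apply: bigcup_sup.
rewrite ltnNge; apply: contra ne12 => le2.
have eq_cover e : e \in V -> e = cover V.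
  by move=> Ve; apply/eqP; rewrite eqEcard sub //= (card_edge (sVF _ Ve)).
by rewrite (eq_cover e1) // (eq_cover e2).
Qed.

(** The balance inequality for the graph spanned by [V], with denominators cleared. Truncated
    subtraction makes the left side 0 when [V] has at most one edge; two edges already span the
    three vertices that balancedness requires. *)
Lemma two_balanced_leq (T : finType) (F : sgraph T) (V : {set {set T}}) :
  two_balanced F -> V \subset edges F ->
  ((#|V| - 1) * (#|T| - 2) <= (#|edges F| - 1) * (#|cover V| - 2))%N.
Proof.
move=> balF sVF; have [V_le1 | V_gt1] := leqP #|V| 1.
  by rewrite (eqP V_le1).
have s_gt2 := card_cover_edges sVF V_gt1.
have v_gt2 := leq_trans s_gt2 (max_card _).
have m_gt1 := leq_trans V_gt1 (subset_leq_card sVF).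
have sub : subgraph F (cover V, V).
  rewrite /subgraph sVF; apply/subsetP => e Ve.
  by rewrite powersetE; apply: bigcup_sup.
have natB i k : (i < k)%N -> k%:R - i%:R = (k - i)%:R :> rat.
  by move=> /ltnW le_ik; rewrite natrB.
have := balF _ sub s_gt2; rewrite /= !(natB 1%N) ?(natB 2%N) //.
rewrite ler_pdivrMr ?ltr0n ?subn_gt0 // mulrAC.
by rewrite ler_pdivlMr ?ltr0n ?subn_gt0 // -!natrM ler_nat.
Qed.

(** Taking all edges for [V] and cancelling [#|edges F| - 1] shows that no vertex is isolated. *)
Lemma two_balanced_cover (T : finType) (F : sgraph T) :
  two_balanced F -> (1 < #|edges F|)%N -> cover (edges F) = [set: T].
Proof.
move=> balF m_gt1; apply/eqP; rewrite eqEcard subsetT cardsT /=.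
have := two_balanced_leq balF (subxx _); rewrite leq_pmul2l ?subn_gt0 //.
by rewrite leq_sub2rE // ltnW // (card_cover_edges (subxx _)).
Qed.

(** * Unions of cliques and the copies of [F] in them *)

Lemma clique_edgesP (U : finType) (A : {set {set U}}) :
  [forall e in [set e : {set U} | (#|e| == 2) && [exists K in A, e \subset K]],
    #|e| == 2].
Proof. by apply/forall_inP => e; rewrite inE => /andP[]. Qed.

Definition clique_graph (U : finType) (A : {set {set U}}) : sgraph U :=
  SGraph (clique_edgesP A).

Lemma card_copies_clique_graph (U : finType) r (A : {set {set U}}) :
  {in A, forall K : {set U}, #|K| = r} ->
  (#|A| <= #|copies (complete_graph r) (clique_graph A)|)%N.
Proof.
move=> cardA.
pose full (K : {set U}) :=
  (K, [set e : {set U} | (#|e| == 2) && (e \subset K)]).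
have full_inj : injective full by move=> K L [].
rewrite -(card_imset _ full_inj); apply: subset_leq_card.
apply/subsetP=> _ /imsetP[K AK ->]; rewrite inE; apply/andP; split.
  apply/andP; split; apply/subsetP => e; rewrite !inE => /andP[e2 sub] //=.
  by rewrite e2; apply/exists_inP; exists K.
pose f := [ffun i : 'I_r => enum_val (cast_ord (esym (cardA K AK)) i)].
have f_inj : injective f.
  by move=> i j; rewrite !ffunE => /enum_val_inj/cast_ord_inj.
have f_im : f @: [set: 'I_r] = K.
  apply/eqP; rewrite eqEcard card_imset // cardsT card_ord cardA // leqnn andbT.
  by apply/subsetP=> _ /imsetP[i _ ->]; rewrite ffunE enum_valP.
apply/existsP; exists f; rewrite f_im eqxx /=; apply/andP; split.
  exact/injectiveP.
apply/eqP/setP => e; rewrite inE; apply/imsetP/andP => [[d + ->] | [e2 sub]].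
  by rewrite inE card_imset // -f_im imsetS ?subsetT.
have e_im : f @: (f @^-1: e) = e.
  apply/setP=> x; apply/imsetP/idP => [[i + ->] | ex]; first by rewrite inE.
  have := subsetP sub x ex; rewrite -f_im => /imsetP[i _ def_x].
  by exists i; rewrite // inE -def_x.
by exists (f @^-1: e); rewrite // inE -(card_imset _ f_inj) e_im.
Qed.

Lemma is_freePn (T U : finType) (F : sgraph T) (G : sgraph U) :
  ~~ is_free F G ->
  exists2 f : {ffun T -> U}, injective f
    & {in edges F, forall e : {set T}, f @: e \in edges G}.
Proof.
case/set0Pn=> -[W D]; rewrite inE => /andP[/andP[sDG _]].
case/existsP=> f /and3P[/injectiveP f_inj _ /eqP def_D].
exists f => // e Fe; apply: (subsetP sDG).
by rewrite -[(W, D).2]def_D; apply/imsetP; exists e.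
Qed.

(* A placement of the vertices of F, a partition of its edges, and for each
   block of the partition the r-set covering it. *)
Notation config T U :=
  ({ffun T -> U} * {set {set {set T}}} * {ffun {set {set T}} -> {set U}})%type.

(** Injectivity of [psi] on [P] makes the blocks need [#|P|] distinct chosen sets, hence probability
    [p ^+ #|P|]. The default [set0] off [P] lets the blocks alone determine [psi]. *)
Definition bad_config (T U : finType) (F : sgraph T) (r : nat)
    (c : config T U) : bool :=
  let: (f, P, psi) := c in
  [&& injectiveb f, partition P (edges F), (1 < #|P|)%N,
      psi \in pfamily set0 P
        (fun V => [set K : {set U} | (#|K| == r) && (f @: cover V \subset K)])
    & dinjectiveb psi P].

(** Assign to each edge a chosen set covering its image; the blocks are the fibres of this map. A
    single block would put the images of all vertices of [F] in one set of size [r < #|T|]. *)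
Lemma clique_graph_bad_config (T U : finType) (F : sgraph T) r
    (A : {set {set U}}) :
  cover (edges F) = [set: T] -> (r < #|T|)%N ->
  {in A, forall K : {set U}, #|K| = r} -> ~~ is_free F (clique_graph A) ->
  exists f P psi, bad_config F r (f, P, psi) && (psi @: P \subset A).
Proof.
move=> coverF lt_rv cardA /is_freePn[f f_inj f_edge].
set E := edges F in coverF *.
pose phi (e : {set T}) := odflt set0 [pick K in A | f @: e \subset K].
have phiP e : e \in E -> phi e \in A /\ f @: e \subset phi e.
  move=> Ee; rewrite /phi; case: pickP => [K /andP[]// | noK].
  have := f_edge e Ee; rewrite inE => /andP[_ /exists_inP[K AK sub]].
  by move: (noK K); rewrite AK sub.
pose P := preim_partition phi E.
have partP : partition P E by apply: preim_partitionP.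
pose cls (e : {set T}) := [set e' in E | phi e == phi e'].
have clsP e : e \in E -> cls e \in P by move=> Ee; apply: imset_f.
pose psi := [ffun V : {set {set T}} =>
  if V \in P then phi (odflt set0 [pick e in V]) else set0].
have psiE e : e \in E -> psi (cls e) = phi e.
  move=> Ee; rewrite ffunE clsP //; case: pickP => [e' | /(_ e)] /=.
    by rewrite inE => /andP[_ /eqP].
  by rewrite inE Ee eqxx.
have P_gt1 : (1 < #|P|)%N.
  rewrite ltnNge; apply: contraL (lt_rv) => /card_le1_eqP P_le1.
  rewrite -leqNgt.
  have v_gt0 : (0 < #|[set: T]|)%N by rewrite cardsT (leq_ltn_trans _ lt_rv).
  have /card_gt0P[t] := v_gt0; rewrite -coverF => /bigcupP[e0 Ee0 _].
  have phi_const e : e \in E -> phi e = phi e0.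
    move=> Ee; have : cls e = cls e0 by apply: P_le1; apply: clsP.
    by move/setP/(_ e); rewrite !inE Ee eqxx => /esym/eqP.
  rewrite -(cardA (phi e0)); last by case: (phiP e0 Ee0).
  rewrite -cardsT -(card_imset _ f_inj); apply: subset_leq_card.
  apply/subsetP=> _ /imsetP[t' + ->]; rewrite -coverF => /bigcupP[e Ee et'].
  case: (phiP e Ee) => _ /subsetP sub.
  by rewrite -(phi_const e Ee) sub // imset_f.
exists f, P, psi; apply/andP; split; last first.
  apply/subsetP=> _ /imsetP[_ /imsetP[e Ee ->] ->].
  by rewrite psiE //; case: (phiP e Ee).
apply/and5P; split=> //.
- exact/injectiveP.
- apply/pfamilyP; split.
    by apply/supportP => V P'V; rewrite ffunE (negPf P'V).
  move=> _ /imsetP[e Ee ->]; rewrite psiE // inE cardA ?eqxx /=; last first.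
    by case: (phiP e Ee).
  apply/subsetP=> _ /imsetP[t /bigcupP[e' + e't] ->].
  rewrite inE => /andP[Ee' /eqP->].
  by case: (phiP e' Ee') => _ /subsetP-> //; apply: imset_f.
- apply/dinjectiveP => _ _ /imsetP[e1 E1 ->] /imsetP[e2 E2 ->].
  by rewrite !psiE // => eq_phi; apply/setP=> e'; rewrite !inE eq_phi.
Qed.

(** There are at most [#|U| ^ #|T|] placements [f]. For fixed [f] and [P], the choices of [psi]
    multiply over the blocks, and [card_supersets] bounds each factor. *)
Lemma sum_bad_config (R : realFieldType) (T U : finType) (F : sgraph T) r
    (p : R) :
  0 <= p -> (0 < #|U|)%N ->
  \sum_(c : config T U | bad_config F r c) p ^+ #|c.2 @: c.1.2| <=
  #|U|%:R ^+ #|T| * \sum_(P | partition P (edges F) && (1 < #|P|)%N)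
    \prod_(V in P) (p * (#|U|%:R ^+ r / #|U|%:R ^+ #|cover V|)).
Proof.
move=> p_ge0 U_gt0.
pose fam (f : {ffun T -> U}) (V : {set {set T}}) :=
  [set K : {set U} | (#|K| == r) && (f @: cover V \subset K)].
pose rest (P : {set {set {set T}}}) := partition P (edges F) && (1 < #|P|)%N.
pose h (P : {set {set {set T}}}) :=
  \prod_(V in P) (p * (#|U|%:R ^+ r / #|U|%:R ^+ #|cover V|)).
have h_ge0 P : 0 <= h P.
  by apply: prodr_ge0 => V _; rewrite mulr_ge0 ?divr_ge0 ?exprn_ge0.
apply: (@le_trans _ _ (\sum_(fP : {ffun T -> U} * {set {set {set T}}} |
     injectiveb fP.1 && rest fP.2)
   \sum_(psi in pfamily set0 fP.2 (fam fP.1)) p ^+ #|fP.2|)).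
  rewrite pair_big_dep /= big_mkcond [leRHS]big_mkcond /=.
  apply: ler_sum => -[[f P] psi] _ /=; rewrite /rest.
  case: ifP => [/and5P[-> -> -> -> /dinjectiveP psi_inj] | _] /=.
    by rewrite card_in_imset.
  by case: ifP; rewrite ?exprn_ge0.
apply: (@le_trans _ _ (\sum_(fP : {ffun T -> U} * {set {set {set T}}} |
     injectiveb fP.1 && rest fP.2) h fP.2)).
  apply: ler_sum => -[f P] /= /andP[/injectiveP f_inj _].
  rewrite sumr_const card_pfamily foldrE big_image -mulr_natr natr_prod.
  rewrite -prodr_const -big_split /=; apply: ler_prod => V _.
  rewrite mulr_ge0 //= ler_wpM2l // ler_pdivlMr ?exprn_gt0 ?ltr0n //.
  rewrite -!natrX -natrM ler_nat -(card_imset _ f_inj).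
  exact: card_supersets.
rewrite -(pair_big (fun f : {ffun T -> U} => injectiveb f) rest (fun _ => h)) /=.
rewrite sumr_const -[leLHS]mulr_natl ler_wpM2r ?sumr_ge0 //.
rewrite -natrX ler_nat -card_ffun.
exact: max_card.
Qed.

Lemma ex_copies_ge_expectation (R : realFieldType) (T : finType) (F : sgraph T)
    (r n : nat) (p : R) :
  cover (edges F) = [set: T] -> (r < #|T|)%N -> (0 < n)%N -> 0 <= p <= 1 ->
  p * 'C(n, r)%:R - n%:R ^+ #|T| *
    \sum_(P | partition P (edges F) && (1 < #|P|)%N)
      \prod_(V in P) (p * (n%:R ^+ r / n%:R ^+ #|cover V|)) <=
  (ex_copies n (complete_graph r) F)%:R.
Proof.
move=> coverF lt_rv n_gt0 p01; have /andP[p_ge0 _] := p01.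
pose D := [set K : {set 'I_n} | #|K| == r].
pose B (c : config T 'I_n) := c.2 @: c.1.2.
have B_n0 c : bad_config F r c -> B c != set0.
  case: c => [[f P] psi] /and5P[_ _ P_gt1 _ _].
  have /card_gt0P[V PV] := ltnW P_gt1.
  by apply/set0Pn; exists (psi V); apply: imset_f.
have [A [sAD A_indep A_large]] := deletion_method D p01 B_n0.
have cardA : {in A, forall K : {set 'I_n}, #|K| = r}.
  by move=> K /(subsetP sAD); rewrite inE => /eqP.
have A_free : is_free F (clique_graph A).
  apply: contraT => /(clique_graph_bad_config coverF lt_rv cardA).
  case=> f [P [psi /andP[bad sub]]].
  by have := A_indep _ bad; rewrite sub.
apply: (@le_trans _ _ #|A|%:R); last first.
  rewrite ler_nat (leq_trans (card_copies_clique_graph cardA)) //.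
  exact: leq_bigmax_cond.
apply: le_trans A_large; rewrite card_draws card_ord lerB //.
by have := @sum_bad_config R T 'I_n F r p p_ge0; rewrite card_ord; apply.
Qed.

(** * Choice of the probability and asymptotics *)

(** Comparing exponents of [n] reduces this to [x (#|V| - 1) <= #|cover V| - 2], which is
    2-balancedness. *)
Lemma clique_weight_le (R : realType) (T : finType) (F : sgraph T)
    (V : {set {set T}}) (n r : nat) (c x : R) :
  two_balanced F -> V \subset edges F -> (0 < #|V|)%N -> (1 < #|edges F|)%N ->
  (2 < #|T|)%N -> (0 < n)%N -> 0 <= c ->
  x = (#|T|%:R - 2) / (#|edges F|%:R - 1) ->
  c * n%:R `^ (2 - r%:R - x) * (n%:R ^+ r / n%:R ^+ #|cover V|) <=
  c * (n%:R `^ (- x)) ^+ #|V|.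
Proof.
move=> balF sVF V_gt0 m_gt1 v_gt2 n_gt0 c_ge0 def_x.
have n_gt0R : 0 < n%:R :> R by rewrite ltr0n.
have n_n0 : n%:R != 0 :> R by rewrite gt_eqF.
rewrite -mulrA ler_wpM2l // -!powR_mulrn ?powR_ge0 ?ler0n // -powRN.
rewrite -!powRD ?n_n0 ?implybT // -powRrM; apply: ler_powR; rewrite ?ler1n //.
have s_ge2 : (1 < #|cover V|)%N.
  have /card_gt0P[e Ve] := V_gt0.
  apply: (@leq_trans #|e|); first by rewrite (card_edge (subsetP sVF _ Ve)).
  by apply: subset_leq_card; apply: bigcup_sup.
suff : x * (#|V|%:R - 1) <= #|cover V|%:R - 2 by lra.
rewrite def_x mulrAC ler_pdivrMr ?subr_gt0 ?ltr1n //.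
have := two_balanced_leq balF sVF; rewrite -(ler_nat R) !natrM.
rewrite !natrB // ?(ltnW v_gt2) ?(ltnW m_gt1) //; lra.
Qed.

Lemma ex_copies_lower_bound (R : realType) (T : finType) (F : sgraph T)
    (r : nat) :
  two_balanced F -> (1 < #|edges F|)%N -> (1 < r)%N -> (r < #|T|)%N ->
  exists2 k : R, 0 < k & forall n, (r <= n)%N ->
    k * n%:R `^ (2 - (#|T|%:R - 2) / (#|edges F|%:R - 1)) <=
    (ex_copies n (complete_graph r) F)%:R.
Proof.
move=> balF m_gt1 r_gt1 lt_rv; set x : R := _ / _.
(* [d] is the constant in the lower bound [d n^r] for the binomial coefficient; [K] bounds the
   number of partitions of the edge set. *)
pose d : R := (r`! * r ^ r)%:R^-1.
pose K : R := #|{set {set {set T}}}|%:R.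
have dN_gt0 : (0 < r`! * r ^ r)%N.
  by rewrite muln_gt0 fact_gt0 expn_gt0 (ltnW r_gt1).
have d_gt0 : 0 < d by rewrite invr_gt0 ltr0n.
have d_le1 : d <= 1 by rewrite invf_le1 ?ltr0n // ler1n.
have K_ge1 : 1 <= K by rewrite ler1n; apply/card_gt0P; exists set0.
have K_gt0 : 0 < K by lra.
have x_ge0 : 0 <= x by rewrite divr_ge0 // subr_ge0 ?ler1n ?ler_nat; lia.
(* With this [c] the error term [K c^2 y] is exactly half of the main term [c d y]. *)
have [c c_gt0 [c_le1 cK]] : exists2 c, 0 < c & c <= 1 /\ c * K = d / 2.
  exists (d / (2 * K)); first by rewrite divr_gt0 // mulr_gt0.
  split; first by rewrite ler_pdivrMr ?mulr_gt0 //; lra.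
  by field; rewrite gt_eqF.
exists (c * d / 2) => [|n le_rn]; first by rewrite divr_gt0 // mulr_gt0.
have n_gt0 : (0 < n)%N by lia.
have v_gt2 : (2 < #|T|)%N by lia.
have n_gt0R : 0 < n%:R :> R by rewrite ltr0n.
have n_n0 : n%:R != 0 :> R by rewrite gt_eqF.
pose p := c * n%:R `^ (2 - r%:R - x).
have p01 : 0 <= p <= 1.
  rewrite mulr_ge0 ?powR_ge0 ?(ltW c_gt0) //=.
  rewrite mulr_ile1 ?powR_ge0 ?(ltW c_gt0) //.
  (* The exponent [2 - r - x] is nonpositive because [r >= 2] and [x >= 0]. *)
  rewrite -[leRHS](powRr0 n%:R); apply: ler_powR; rewrite ?ler1n //.
  by have : 2 <= r%:R :> R by [rewrite ler_nat]; lra.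
set y := n%:R `^ (2 - x); have y_ge0 : 0 <= y by apply: powR_ge0.
have coverF := two_balanced_cover balF m_gt1.
apply: le_trans (ex_copies_ge_expectation coverF lt_rv n_gt0 p01).
have main_term : c * d * y <= p * 'C(n, r)%:R.
  rewrite /p -!mulrA ler_wpM2l ?(ltW c_gt0) //.
  have -> : y = n%:R `^ (2 - r%:R - x) * n%:R ^+ r.
    rewrite -powR_mulrn ?ler0n // -powRD ?n_n0 ?implybT //.
    by congr (_ `^ _); ring.
  rewrite mulrCA ler_wpM2l ?powR_ge0 // /d mulrC ler_pdivrMr ?ltr0n //.
  by rewrite -natrX -natrM ler_nat leq_expn_bin // (ltnW r_gt1).
set S := \sum_(P | _) _.
have S_le : S <= K * (c ^+ 2 * (n%:R `^ (- x)) ^+ #|edges F|).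
  rewrite mulr_natl -sumr_const /S big_mkcond /=.
  apply: ler_sum => P _; case: ifP => [/andP[partP P_gt1]|_]; last first.
    by rewrite mulr_ge0 ?exprn_ge0 ?powR_ge0 ?(ltW c_gt0).
  apply: (@le_trans _ _ (\prod_(V in P) (c * (n%:R `^ (- x)) ^+ #|V|))).
    apply: ler_prod => V PV; have [/eqP coverP _ P0] := and3P partP.
    rewrite mulr_ge0 ?divr_ge0 ?exprn_ge0 //=; last by case/andP: p01.
    have sVF : V \subset edges F by rewrite -coverP; apply: bigcup_sup.
    have V_gt0 : (0 < #|V|)%N by rewrite card_gt0; apply: contraNneq P0 => <-.
    by rewrite /p; apply: clique_weight_le sVF _ _ _ _ (ltW c_gt0) erefl.
  rewrite big_split /= prodr_const prodrXr -(card_partition partP).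
  rewrite ler_wpM2r ?exprn_ge0 ?powR_ge0 //.
  (* At least two blocks and [c <= 1] give [c ^+ #|P| <= c ^+ 2]. *)
  by rewrite ler_wiXn2l // ltW.
have bad_term : n%:R ^+ #|T| * S <= c * d / 2 * y.
  apply: (@le_trans _ _ (n%:R ^+ #|T| *
      (K * (c ^+ 2 * (n%:R `^ (- x)) ^+ #|edges F|)))).
    by rewrite ler_wpM2l ?exprn_ge0.
  (* With [m] edges and [v] vertices, [x (m - 1) = v - 2] gives [v - x m = 2 - x]. *)
  have -> : y = n%:R ^+ #|T| * (n%:R `^ (- x)) ^+ #|edges F|.
    rewrite -!powR_mulrn ?powR_ge0 ?ler0n // -powRrM -powRD ?n_n0 ?implybT //.
    congr (_ `^ _); rewrite /x; field.
    by rewrite subr_eq0 pnatr_eq1 gtn_eqF.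
  have -> : c * d / 2 = K * c ^+ 2 by rewrite -mulrA -cK; ring.
  by rewrite mulrCA -[leRHS]mulrA [in leRHS](mulrCA (c ^+ 2)).
rewrite lerBrDr (le_trans (lerD (lexx _) bad_term)) //.
rewrite (le_trans _ main_term) //.
by rewrite -mulrDl -splitr.
Qed.

(* Imported only here because [classical_sets] shadows finite-set notions such
   as [subsetP], [cover] and [partition]. *)
From mathcomp Require Import boolp classical_sets reals topology normedtype.
From mathcomp Require Import landau.
Import numFieldNormedType.Exports.
Local Open Scope classical_set_scope.
Local Open Scope ring_scope.

Theorem theorem1p5 (R : realType) (T : finType) (F : sgraph T)
    (F_balanced : two_balanced F) (F_edges : (2 <= #|edges F|)%N)
    (r : nat) (r_ge2 : (2 <= r)%N) (r_lt : (r < #|T|)%N) :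
  (fun n : nat => (ex_copies n (complete_graph r) F)%:R : R) \is
    'Omega_\oo (fun n : nat =>
      n%:R `^ (2 - (#|T|%:R - 2) / (#|edges F|%:R - 1)) : R).
Proof.
have [k k_gt0 k_le] := ex_copies_lower_bound R F_balanced F_edges r_ge2 r_lt.
apply/asboolP; exists k => //; exists r => // n /= le_rn.
by rewrite !ger0_norm ?powR_ge0 ?ler0n // k_le.
Qed.
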